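(* Let $f\in S=\mathbb{C}[x_0,\dots,x_n]$ be a homogeneous polynomial of degree $d\ge 2$, let $V(f):f=0$ be the corresponding hypersurface in $\mathbb{P}^n$, and let $T=(n+1)(d-2)$. (i) If $V(f)$ is smooth, then $$HP(H_{n+1}(f);t)=HP(M(f);t)-t^{T}=\frac{(1-t^{d-1})^{n+1}}{(1-t)^{n+1}}-t^{T}.$$ (ii) If $V(f)$ is reduced, has only isolated singularities and is not smooth, then $$HP(H_{n+1}(f);t)=HP(M(f);t).$$
   Context: $S=\mathbb{C}[x_0,\dots,x_n]$ with the standard grading. $J_f$ is the ideal of $S$ generated by the partial derivatives $f_0,\dots,f_n$ of $f$, and $M(f)=S/J_f$ is the graded Milnor algebra. $h(f)=\det(f_{ij})_{0\le i,j\le n}$ is the Hessian determinant of $f$, and $H_{n+1}(f)=S/(J_f+(h(f)))$. For a graded $\mathbb{C}$-algebra $A=\bigoplus_k A_k$ with finite dimensional components, $HP(A;t)=\sum_k \dim_{\mathbb{C}}(A_k)\,t^k$. *)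

(* Defs.v *)
From HB Require Import structures.
From mathcomp Require Import all_boot all_order all_algebra.
From mathcomp Require Import boolp classical_sets reals complex.
From mathcomp Require Import mpoly.

Set Implicit Arguments.
Unset Strict Implicit.
Unset Printing Implicit Defensive.

Import Order.TTheory GRing.Theory Num.Theory.

Local Open Scope classical_set_scope.
Local Open Scope ring_scope.

Definition is_ideal (A : comNzRingType) (I : set A) : Prop :=
  [/\ I 0, forall x y, I x -> I y -> I (x + y) & forall a x, I x -> I (a * x)].

Definition ideal_gen (A : comNzRingType) (J : finType) (g : J -> A) : set A :=
  [set x | exists a : J -> A, x = \sum_j a j * g j].

Definition ideal_add (A : comNzRingType) (I J : set A) : set A :=
  [set x | exists y z, [/\ I y, J z & x = y + z]].

Definition principal (A : comNzRingType) (a : A) : set A :=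
  ideal_gen (fun _ : unit => a).

Lemma ideal_gen_ideal (A : comNzRingType) (J : finType) (g : J -> A) :
  is_ideal (ideal_gen g).
Proof.
split.
- by exists (fun=> 0); rewrite big1 // => j _; rewrite mul0r.
- move=> _ _ [a ->] [b ->]; exists (fun j => a j + b j).
  by rewrite -big_split; apply: eq_bigr => j _; rewrite mulrDl.
- move=> c _ [a ->]; exists (fun j => c * a j).
  by rewrite mulr_sumr; apply: eq_bigr => j _; rewrite mulrA.
Qed.

Lemma ideal_add_ideal (A : comNzRingType) (I J : set A) :
  is_ideal I -> is_ideal J -> is_ideal (ideal_add I J).
Proof.
move=> [I0 ID IM] [J0 JD JM]; split.
- by exists 0, 0; rewrite addr0.
- move=> _ _ [y [z [Iy Jz ->]]] [y' [z' [Iy' Jz' ->]]].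
  by exists (y + y'), (z + z'); rewrite addrACA; split; [exact: ID|exact: JD|].
- move=> a _ [y [z [Iy Jz ->]]]; exists (a * y), (a * z).
  by rewrite mulrDr; split; [exact: IM|exact: JM|].
Qed.

Section HilbertFunction.
Variables (K : fieldType) (n : nat).
Implicit Types (I : set {mpoly K[n.+1]}) (k : nat).

(* The degree k part of I, as a subspace of the space of forms of degree k.
   The default value 0 is never used when I is an ideal: see mem_ideal_part. *)
Definition ideal_part I k : {vspace dhomog n.+1 K k} :=
  xget 0%VS [set U : {vspace dhomog n.+1 K k} |
              forall p : dhomog n.+1 K k, (p \in U) <-> I (p : {mpoly K[n.+1]})].

(* dim_K (S/I)_k, where (S/I)_k = S_k / I_k; see also hilbert_fun_basis. *)
Definition hilbert_fun I k : nat :=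
  (\dim {: dhomog n.+1 K k} - \dim (ideal_part I k))%N.

End HilbertFunction.

Lemma vspace_of_set (K : fieldType) (V : vectType K) (P : set V) :
  P 0 -> (forall a u v, P u -> P v -> P (a *: u + v)) ->
  exists U : {vspace V}, forall x, (x \in U) <-> P x.
Proof.
move=> P0 PD.
pose Q m := `[< exists U : {vspace V}, (forall x, x \in U -> P x) /\ \dim U = m >].
have exQ : exists m, Q m.
  exists 0%N; apply/asboolP; exists 0%VS; rewrite dimv0; split=> // x.
  by rewrite memv0 => /eqP ->.
have ubQ m : Q m -> (m <= \dim {: V})%N.
  by move=> /asboolP[U [_ <-]]; apply: dimvS; apply: subvf.
case: (ex_maxnP exQ ubQ) => m /asboolP[U [UP dU]] mmax.
exists U => x; split; first exact: UP.
move=> Px; apply/idP; apply: contraT => xU.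
have /mmax : Q (\dim (U + <[x]>)%VS).
  apply/asboolP; exists (U + <[x]>)%VS; split=> // y.
  move=> /memv_addP[u uU [w /vlineP[a ->] ->]].
  by rewrite addrC; apply: PD => //; apply: UP.
rewrite -dU => le_dim.
have /eqP eqU : U == (U + <[x]>)%VS by rewrite eqEdim addvSl.
by case/negP: xU; rewrite eqU (subvP (addvSr _ _)) // memv_line.
Qed.

Lemma mem_ideal_part (K : fieldType) (n : nat) (I : set {mpoly K[n.+1]}) k
    (p : dhomog n.+1 K k) :
  is_ideal I -> (p \in ideal_part I k) <-> I (p : {mpoly K[n.+1]}).
Proof.
move=> [I0 ID IM]; rewrite /ideal_part; case: xgetP => [U _ -> //|].
have [||U UP] := @vspace_of_set K (dhomog n.+1 K k) [set q | I (mpoly_of_dhomog q)].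
- exact: I0.
- move=> a u v Iu Iv; apply: (ID (a *: mpoly_of_dhomog u)) => //.
  by rewrite -mul_mpolyC; apply: IM.
- by move=> /(_ U) [].
Qed.

(* A basis of (S/I)_k, i.e. a family of forms of degree k that is independent
   and generating modulo I, has hilbert_fun I k elements. *)
Lemma hilbert_fun_basis (K : fieldType) (n : nat) (I : set {mpoly K[n.+1]}) k m
    (b : m.-tuple (dhomog n.+1 K k)) :
  is_ideal I ->
  (forall c : 'I_m -> K, I (mpoly_of_dhomog (\sum_(i < m) c i *: b`_i)) ->
     forall i, c i = 0) ->
  (forall p : dhomog n.+1 K k, exists c : 'I_m -> K,
     I (mpoly_of_dhomog (p - \sum_(i < m) c i *: b`_i))) ->
  m = hilbert_fun I k.
Proof.
move=> idI bfree bspan.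
have memI p := mem_ideal_part p idI; set U := ideal_part I k in memI.
have I0 : I 0 by case: idI.
have fb : free b.
  apply/freeP => c c0; apply: bfree.
  rewrite c0; exact: I0.
have dir : (<<b>> :&: U)%VS = 0%VS.
  apply/eqP; rewrite -subv0; apply/subvP => x; rewrite memv_cap memv0.
  case/andP => /coord_span xb /memI.
  rewrite {1}xb => /bfree c0.
  by rewrite xb big1 // => i _; rewrite c0 scale0r.
have full : (<<b>> + U)%VS = fullv.
  apply/eqP; rewrite eqEsubv subvf; apply/subvP => x _.
  have [c /memI xc] := bspan x.
  rewrite -[x](subrK (\sum_(i < m) c i *: b`_i)) addrC memv_add //.
  apply: rpred_sum => i _; apply: rpredZ; apply: memv_span.
  by rewrite mem_nth // size_tuple.
rewrite /hilbert_fun -/U -full dimv_disjoint_sum // addnK.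
by move/eqP: fb; rewrite size_tuple.
Qed.

Definition fps := nat -> int.

Definition fps_poly (p : {poly int}) : fps := fun k => p`_k.

Definition fps_mul (F G : fps) : fps :=
  fun k => \sum_(i < k.+1) F i * G (k - i)%N.

(* The expansion of p / q for q with constant term 1: since X divides 1 - q,
   the coefficient of degree k of 1 / q = sum_j (1 - q)^j only involves the
   terms with j <= k. *)
Definition fps_frac (p q : {poly int}) : fps :=
  fun k => (p * \sum_(j < k.+1) (1 - q) ^+ j)`_k.

Lemma fps_fracP (p q : {poly int}) : q`_0 = 1 ->
  fps_mul (fps_poly q) (fps_frac p q) =1 fps_poly p.
Proof.
move=> q0 k; rewrite /fps_mul /fps_frac /fps_poly.
have [r qr] : exists r, 1 - q = r * 'X.
  have : root (1 - q) 0 by rewrite /root horner_coef0 coefB coef1 q0 subrr.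
  by move/factor_theorem => [r]; rewrite subr0; exists r.
have high (g : {poly int}) i j : (i < j)%N -> (g * (1 - q) ^+ j)`_i = 0.
  by move=> ij; rewrite qr exprMn mulrA coefMXn ij.
have trunc i : (i <= k)%N ->
    (p * \sum_(j < i.+1) (1 - q) ^+ j)`_i = (p * \sum_(j < k.+1) (1 - q) ^+ j)`_i.
  move=> ik; rewrite !mulr_sumr !coef_sum.
  rewrite -!(big_mkord xpredT (fun j => (p * (1 - q) ^+ j)`_i)).
  rewrite [RHS](big_cat_nat (n := i.+1)) //= [X in _ = _ + X]big_nat_cond.
  by rewrite [X in _ = _ + X]big1 ?addr0 // => j /andP[/andP[ij _] _]; apply: high.
transitivity ((q * (p * \sum_(j < k.+1) (1 - q) ^+ j))`_k).
  rewrite coefM; apply: eq_bigr => i _; rewrite trunc //; exact: leq_subr.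
have -> : q * (p * \sum_(j < k.+1) (1 - q) ^+ j) = p - p * (1 - q) ^+ k.+1.
  have /= := subrX1 (1 - q) k.+1; rewrite [1 - q - 1]addrAC subrr sub0r => e.
  by rewrite mulrCA -[q * _]opprK -mulNr -e opprB mulrBr mulr1.
by rewrite coefB high ?subr0.
Qed.

Section Hypersurface.
Variables (R : realType) (n : nat).
Local Notation C := (R[i]).
Local Notation S := {mpoly C[n.+1]}.
Implicit Types (f : S) (I : set S).

(* The Hilbert series of the quotient S/I, not of I. *)
Definition HP I : fps := fun k => (hilbert_fun I k)%:Z.

Definition jacobian_ideal f : set S := ideal_gen (fun i => f^`M(i)).

Definition hessian f : S := \det (\matrix_(i, j) f^`M(i)^`M(j)).

Definition jacobian_hessian_ideal f : set S :=
  ideal_add (jacobian_ideal f) (principal (hessian f)).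

Definition HP_M f : fps := HP (jacobian_ideal f).
Definition HP_H f : fps := HP (jacobian_hessian_ideal f).

(* A nonzero row vector stands for the point of P^n having it as homogeneous
   coordinates; two of them define the same point iff they are proportional. *)
Definition singular_point f (x : 'rV[C]_n.+1) : Prop :=
  [/\ x != 0, f.@[x 0] = 0 & forall i, (f^`M(i)).@[x 0] = 0].

Definition smooth_hypersurface f : Prop := forall x, ~ singular_point f x.

(* x is an isolated point of the singular locus for the Zariski topology, whose
   basic open sets are the D(g), with g homogeneous. *)
Definition isolated_singularity f (x : 'rV[C]_n.+1) : Prop :=
  singular_point f x /\
  exists k (g : S), [/\ g \is k.-homog, g.@[x 0] != 0 &
    forall y, singular_point f y -> g.@[y 0] != 0 -> exists c, y = c *: x].

Definition only_isolated_singularities f : Prop :=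
  forall x, singular_point f x -> isolated_singularity f x.

(* S/(f) has no nonzero nilpotent element. *)
Definition reduced_hypersurface f : Prop :=
  forall (g : S) (k : nat), principal f (g ^+ k) -> principal f g.

End Hypersurface.

(* Main.v *)
From HB Require Import structures.
Require Import Defs.
From mathcomp Require Import all_boot all_order all_algebra.
From mathcomp Require Import boolp classical_sets reals complex mpoly.
From mathcomp Require Import perm ring zify.

Set Implicit Arguments.
Unset Strict Implicit.
Unset Printing Implicit Defensive.

Import Order.TTheory GRing.Theory Num.Theory.

Local Open Scope ring_scope.

(** Let J be the ideal of the partial derivatives f_i, h the Hessian determinant and
    e = d - 1. Euler's identity for f_i reads sum_j f_ij X_j = e f_i: the Hessian matrix
    is a transition matrix from the coordinates to a multiple of the gradient, and what
    is needed about h follows from this alone. Cramer's rule puts every X_j h in J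
    ([mul_var_hessian]), so J + (h) exceeds J at most by the line C h, in degree
    (n + 1)(d - 2), and the question is whether h is in J.

    Two transition matrices from the coordinates to the same vector g have the same
    determinant modulo (g) ([det_transition]), because the syzygies of the coordinates are
    generated by the Koszul ones. At a singular point v all f_i vanish, hence the f_i
    have a transition matrix that kills the vector v, whose determinant is 0; so h is in J
    ([hessian_singular]). If V(f) is smooth, J contains a power of each coordinate. Then,
    multiplying by the transition matrix from the f_i to these powers, h in J would put
    the product of the X_j^(N-1) in the ideal of the X_j^N ([transition_det_notin]).

    The Hilbert series of S/J in the smooth case is that of a complete intersection once
    J is generated by a regular sequence of n + 1 forms of degree e. Such a sequence comes
    from the obviously regular one X_0^e, ..., X_n^e by exchanging one power at a time
    for a general member of the pencil sum_i s^i f_i ([exchange]). When one element is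
    left out, the quotient R is one-dimensional, and for large k the forms of degree e
    act on the space R_k, after division by the remaining X_j^e, by commuting matrices.
    In triangular form their diagonal entries are evaluations at points, so that for
    general s the member of the pencil acts with nonzero determinant, as the f_i have
    no common zero. Members with n + 1 distinct parameters generate J by Vandermonde.
    This also yields the powers of the coordinates in J: a regular sequence of length
    n + 1 leaves nothing above degree (n + 1)(e - 1). *)

(** * Ideals *)

Section Ideals.
Variables (A : comNzRingType) (I : set A).
Hypothesis idI : is_ideal I.

Lemma ideal0 : I 0. Proof. by case: idI. Qed.

Lemma idealD x y : I x -> I y -> I (x + y).
Proof. by case: idI => _ + _; apply. Qed.

Lemma idealMl a x : I x -> I (a * x).
Proof. by case: idI => _ _; apply. Qed.

Lemma idealMr a x : I x -> I (x * a).
Proof. by rewrite mulrC; apply: idealMl. Qed.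

Lemma idealN x : I x -> I (- x).
Proof. by rewrite -mulN1r; apply: idealMl. Qed.

Lemma idealB x y : I x -> I y -> I (x - y).
Proof. by move=> Ix /idealN; apply: idealD. Qed.

Lemma ideal_sum (J : Type) (r : seq J) (P : pred J) (F : J -> A) :
  (forall j, P j -> I (F j)) -> I (\sum_(j <- r | P j) F j).
Proof. by move=> IF; elim/big_ind: _ => //; [exact: ideal0|exact: idealD]. Qed.

Lemma ideal_congr x y : I (x - y) -> I y -> I x.
Proof. by move=> Ixy Iy; rewrite -(subrK y x); apply: idealD. Qed.

End Ideals.

Lemma ideal_gen_min (A : comNzRingType) (I : set A) (J : finType) (g : J -> A) x :
  is_ideal I -> (forall j, I (g j)) -> ideal_gen g x -> I x.
Proof. by move=> idI Ig [a ->]; apply: ideal_sum => // j _; apply: idealMl. Qed.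

Lemma ideal_gen_mem (A : comNzRingType) (J : finType) (g : J -> A) j :
  ideal_gen g (g j).
Proof.
exists (fun i => (i == j)%:R); rewrite (bigD1 j) //= eqxx mul1r big1 ?addr0 //.
by move=> i /negPf ->; rewrite mul0r.
Qed.

(** * Determinants of transition matrices *)

Section KoszulRow.
Variables (A : idomainType) (I : set A) (m : nat).
Hypothesis idI : is_ideal I.
Implicit Types (B : 'M[A]_m) (x : 'cV[A]_m).

Definition set_row B i (r : 'I_m -> A) : 'M[A]_m :=
  \matrix_(l, k) if l == i then r k else B l k.

Definition set_col B j x : 'M[A]_m :=
  \matrix_(l, k) if k == j then x l 0 else B l k.

Lemma cofactor_set_row B i r k : cofactor (set_row B i r) i k = cofactor B i k.
Proof.
rewrite /cofactor; congr (_ * \det _); apply/matrixP => a b.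
by rewrite !mxE eq_sym (negPf (neq_lift _ _)).
Qed.

Lemma det_set_row B i r : \det (set_row B i r) = \sum_k r k * cofactor B i k.
Proof.
rewrite (expand_det_row _ i); apply: eq_bigr => k _.
by rewrite cofactor_set_row mxE eqxx.
Qed.

Lemma cofactor_set_col B j x l : cofactor (set_col B j x) l j = cofactor B l j.
Proof.
rewrite /cofactor; congr (_ * \det _); apply/matrixP => a b.
by rewrite !mxE eq_sym (negPf (neq_lift _ _)).
Qed.

Lemma det_set_col B j x : \det (set_col B j x) = \sum_l x l 0 * cofactor B l j.
Proof.
rewrite (expand_det_col _ j); apply: eq_bigr => l _.
by rewrite cofactor_set_col mxE eqxx.
Qed.

Lemma cramer_set_col B x j : x j 0 * \det B = \det (set_col B j (B *m x)).
Proof.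
have <- : (\adj B *m (B *m x)) j 0 = x j 0 * \det B.
  by rewrite mulmxA mul_adj_mx mul_scalar_mx mxE mulrC.
rewrite det_set_col mxE; apply: eq_bigr => l _.
by rewrite [\adj B j l]mxE mulrC.
Qed.

(** The expression is the determinant of B with row i replaced by the Koszul syzygy
    x_j e_k - x_k e_j. The product of that matrix with x is B x with the i-th entry
    zeroed, so Cramer's rule puts x_j times the determinant in I; but the factor x_j can
    be taken out of row i before the expansion. *)
Lemma koszul_cofactor B x i j k :
  x j 0 != 0 -> (forall l, I ((B *m x) l 0)) ->
  I (x j 0 * cofactor B i k - x k 0 * cofactor B i j).
Proof.
move=> xj0 Bx; have [<-|jk] := eqVneq j k; first by rewrite subrr; apply: ideal0.
pose r l : A := x j 0 * (l == k)%:R - x k 0 * (l == j)%:R.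
have sum_r (c : 'I_m -> A) : \sum_l r l * c l = x j 0 * c k - x k 0 * c j.
  under eq_bigr do rewrite mulrBl -!mulrA !mulr_natl.
  rewrite sumrB -!mulr_sumr; congr (_ * _ - _ * _).
    by rewrite (bigD1 k) //= eqxx big1 ?addr0 // => l /negPf ->.
  by rewrite (bigD1 j) //= eqxx big1 ?addr0 // => l /negPf ->.
have rx : \sum_l r l * x l 0 = 0 by rewrite sum_r mulrC subrr.
have -> : x j 0 * cofactor B i k - x k 0 * cofactor B i j = \det (set_row B i r).
  by rewrite det_set_row sum_r.
pose y : 'cV_m := \col_l if l == i then 0 else (B *m x) l 0.
have ry : set_row B i r *m x = y.
  apply/matrixP => l q; rewrite ord1 !mxE; case: eqVneq => [->|li].
    by rewrite -[RHS]rx; apply: eq_bigr => s _; rewrite mxE eqxx.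
  by apply: eq_bigr => s _; rewrite mxE (negPf li).
(* The matrix whose determinant Cramer's rule equates with x_j times this one
   has x_j e_k as its row i, so x_j can be cancelled. *)
pose D := set_col (set_row B i (fun l => (l == k)%:R)) j y.
suff -> : \det (set_row B i r) = \det D.
  rewrite det_set_col; apply: ideal_sum => // l _; apply: idealMr => //.
  by rewrite mxE; case: ifP => // _; apply: ideal0.
apply: (mulfI xj0); rewrite cramer_set_col ry.
rewrite (@determinant_multilinear _ _ _ D D i (x j 0) 0) ?mul0r ?addr0 //.
- apply/matrixP => a l; rewrite !mxE eqxx /r; case: (eqVneq l j) => [_|lj].
    by rewrite mulr0 mul0r addr0.
  by rewrite mulr0 subr0 mul0r addr0.
- by apply/matrixP => a l; rewrite !mxE [_ == i]eq_sym (negPf (neq_lift _ _)).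
- by apply/matrixP => a l; rewrite !mxE [_ == i]eq_sym (negPf (neq_lift _ _)).
Qed.

End KoszulRow.

Lemma alternating_pair (A : comNzRingType) (x y a b u v : A) :
  x * (a - b) * u + y * (b - a) * v = (a - b) * (x * u - y * v).
Proof. by ring. Qed.

Section KoszulSyzygies.
Variables (K : numFieldType) (n : nat).
Local Notation S := {mpoly K[n.+1]}.
Implicit Types (p q f : S) (I : set S).

Lemma euler_monomial (m : 'X_{1..n.+1}) i :
  'X_i * 'X_[m]^`M(i) = (m i)%:R *: 'X_[m] :> S.
Proof.
rewrite mderivX -scalerAr -mpolyXD; case: (posnP (m i)) => [->|mi].
  by rewrite !scale0r.
congr (_ *: 'X_[_]); apply/mnmP => j; rewrite mnmDE mnmBE mnm1E.
by case: eqVneq => [<-|_]; rewrite ?subnKC // add0n subn0.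
Qed.

Lemma euler k p : p \is k.-homog -> \sum_i 'X_i * p^`M(i) = k%:R *: p.
Proof.
move=> /dhomogP hp; rewrite {2}(mpolyE p) scaler_sumr.
under eq_bigr => i _ do rewrite {1}(mpolyE p) linear_sum mulr_sumr.
rewrite exchange_big /=; rewrite big_seq [RHS]big_seq; apply: eq_bigr => m mp.
under eq_bigr => i _ do rewrite linearZ -scalerAr euler_monomial scalerA mulrC.
rewrite -scaler_suml -mulr_suml -natr_sum scalerA; congr ((_%:R * _) *: _).
by have := hp m mp; rewrite /= mdegE => <-.
Qed.

Lemma mderiv_homog k p i : p \is k.-homog -> p^`M(i) \is k.-1.-homog.
Proof.
move=> hp; apply/dhomogP => m; rewrite mcoeff_msupp mcoeff_deriv => nz.
have /(dhomog_mf hp) : (m + U_(i))%MM \in msupp p.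
  by rewrite mcoeff_msupp; apply: contraNneq nz => ->; rewrite mul0rn.
by rewrite /= mdegD mdeg1 addn1 => <-.
Qed.

Lemma pihomogMl d e p q : p \is d.-homog ->
  pihomog mdeg (d + e) (p * q) = p * pihomog mdeg e q.
Proof.
move=> hp; pose N := maxn (msize q) e.+1.
rewrite {1}(@pihomog_partitionE _ _ mdeg N q) ?leq_maxl //.
rewrite mulr_sumr linear_sum (bigD1 (Ordinal (leq_maxr (msize q) e.+1))) //=.
rewrite pihomog_dE ?big1 ?addr0 //; last exact: dhomogM hp (pihomogP _ _ _).
move=> j; rewrite -val_eqE /= => je.
by rewrite (@pihomog_ne0 _ _ _ (d + j)) ?eqn_add2l // (dhomogM hp) ?pihomogP.
Qed.

Lemma pihomogMl_small d k p q : p \is d.-homog -> (k < d)%N ->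
  pihomog mdeg k (p * q) = 0.
Proof.
move=> hp kd; rewrite {1}(@pihomog_partitionE _ _ mdeg (msize q) q) //.
rewrite mulr_sumr linear_sum big1 //= => j _.
by rewrite (@pihomog_ne0 _ _ _ (d + j)) ?gtn_eqF ?ltn_addr // (dhomogM hp) ?pihomogP.
Qed.

Lemma homogX k (i : 'I_n.+1) : 'X_i ^+ k \is [in K[n.+1], k.-homog].
Proof. by rewrite -{2}[k]mul1n; apply: dhomogMn; rewrite dhomogX /= mdeg1. Qed.

Lemma homogXi (i : 'I_n.+1) : 'X_i \is [in K[n.+1], 1.-homog].
Proof. by rewrite dhomogX /= mdeg1. Qed.

(** The syzygies of the coordinates are generated by the Koszul ones. Up to the
    factor k + 1, a syzygy r of degree k is the sum of the X_j A_jl e_l for the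
    alternating matrix A_jl = d_j r_l - d_l r_j, by Euler's identity applied to r_l
    and the derivative along X_l of the relation. *)
Lemma koszul_homog k (r : 'I_n.+1 -> S) :
  (forall j, r j \is k.-homog) -> \sum_j r j * 'X_j = 0 ->
  forall l, k.+1%:R *: r l = \sum_j 'X_j * ((r l)^`M(j) - (r j)^`M(l)).
Proof.
move=> hr r0 l; under eq_bigr do rewrite mulrBr.
rewrite sumrB (euler (hr l)).
have := congr1 (mderiv l) r0; rewrite linear_sum mderiv0 /=.
have -> : \sum_j (r j * 'X_j)^`M(l) = \sum_j 'X_j * (r j)^`M(l) + r l.
  under eq_bigr do rewrite mderivM mderivX mnm1E mulrC.
  rewrite big_split /=; congr (_ + _); rewrite (bigD1 l) //= eqxx scale1r.
  have -> : (U_(l) - U_(l) = 0)%MM by apply/mnmP => j; rewrite mnmBE mnm0E subnn.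
  rewrite mpolyX0 mulr1 big1 ?addr0 // => j /negPf ->.
  by rewrite scale0r mulr0.
by move/eqP; rewrite addr_eq0 => /eqP ->; rewrite opprK -natr1 scalerDl scale1r.
Qed.

(** Replacing a row of a transition matrix B by a syzygy of the coordinates yields
    a determinant in any ideal containing the entries of B X, by reduction to Koszul
    syzygies in each degree. *)
Lemma syzygy_cofactor I (B : 'M[S]_n.+1) i (r : 'I_n.+1 -> S) :
  is_ideal I -> (forall l, I (\sum_j B l j * 'X_j)) -> \sum_j r j * 'X_j = 0 ->
  I (\sum_l r l * cofactor B i l).
Proof.
move=> idI IB r0; pose N := \max_j msize (r j).
have rE l : r l = \sum_(k < N) pihomog mdeg k (r l).
  by apply: pihomog_partitionE; apply: leq_bigmax.
under eq_bigr => l _ do rewrite rE mulr_suml.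
rewrite exchange_big; apply: ideal_sum => // k _ /=.
set s := fun l => pihomog mdeg k (r l).
have hs l : s l \is k.-homog by apply: pihomogP.
have s0 : \sum_j s j * 'X_j = 0.
  transitivity (pihomog mdeg (1 + k) (\sum_j r j * 'X_j)); last by rewrite r0 linear0.
  rewrite linear_sum; apply: eq_bigr => j _ /=.
  by rewrite mulrC -(pihomogMl _ _ (homogXi j)) mulrC.
have nz : k.+1%:R *+ 2 != 0 :> K by rewrite -mulrnA pnatr_eq0 muln_eq0.
suff : I ((k.+1%:R *+ 2) *: \sum_l s l * cofactor B i l).
  move/(idealMl idI ((k.+1%:R *+ 2)^-1)%:MP).
  by rewrite mul_mpolyC scalerA mulVf // scale1r.
(* Each Koszul syzygy occurs twice in the double sum, as (l, j) and as (j, l). *)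
have sym : (k.+1%:R *+ 2) *: \sum_l s l * cofactor B i l =
    \sum_l \sum_j ((s l)^`M(j) - (s j)^`M(l)) *
      ('X_j * cofactor B i l - 'X_l * cofactor B i j).
  pose F l j := 'X_j * ((s l)^`M(j) - (s j)^`M(l)) * cofactor B i l.
  have FE : k.+1%:R *: (\sum_l s l * cofactor B i l) = \sum_l \sum_j F l j.
    rewrite scaler_sumr; apply: eq_bigr => l _.
    by rewrite scalerAl (koszul_homog hs s0) mulr_suml.
  rewrite mulr2n scalerDl {1}FE FE {2}exchange_big /= -big_split /=.
  apply: eq_bigr => l _; rewrite -big_split /=; apply: eq_bigr => j _.
  exact: alternating_pair.
rewrite sym; apply: ideal_sum => // l _; apply: ideal_sum => // j _.
apply: idealMl => //.
have X0 a : 'X_a != 0 :> S.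
  by apply/eqP => /(congr1 (fun p => p@_U_(a))) /eqP;
     rewrite mcoeffX eqxx mcoeff0 oner_eq0.
have := @koszul_cofactor _ I n.+1 idI B (\col_a 'X_a) i j l.
rewrite !mxE; apply=> [|a]; first exact: X0.
by rewrite mxE; under eq_bigr do rewrite mxE.
Qed.
End KoszulSyzygies.

Section TransitionMatrices.
Variables (K : numFieldType) (n : nat).
Local Notation S := {mpoly K[n.+1]}.
Implicit Types (p q f : S) (I : set S).

(** The matrices are exchanged one row at a time; the difference of two rows with the
    same product with the coordinates is a syzygy. *)
Lemma det_transition I (B B' : 'M[S]_n.+1) (g : 'I_n.+1 -> S) :
  is_ideal I -> (forall l, I (g l)) ->
  (forall l, \sum_j B l j * 'X_j = g l) ->
  (forall l, \sum_j B' l j * 'X_j = g l) ->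
  I (\det B - \det B').
Proof.
move=> idI Ig Bg B'g.
pose M k : 'M[S]_n.+1 := \matrix_(i, j) if (i < k)%N then B' i j else B i j.
have Mg k l : \sum_j M k l j * 'X_j = g l.
  case lk: (l < k)%N; [rewrite -(B'g l)|rewrite -(Bg l)];
    by apply: eq_bigr => j _; rewrite mxE lk.
suff: forall k, (k <= n.+1)%N -> I (\det B - \det (M k)).
  move/(_ n.+1 (leqnn _)).
  by have -> : M n.+1 = B' by apply/matrixP => i j; rewrite mxE ltn_ord.
elim=> [_|k IHk kn].
  have -> : M 0%N = B by apply/matrixP => i j; rewrite mxE.
  by rewrite subrr; apply: ideal0.
rewrite -(subrKA (\det (M k))); apply: idealD => //; first exact/IHk/ltnW.
pose i := Ordinal kn.
have -> : M k.+1 = set_row (M k) i (B' i).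
  apply/matrixP => a b; rewrite !mxE ltnS leq_eqVlt -val_eqE /=.
  by case: eqVneq => [ak|_] //=; have -> : a = i by apply: val_inj.
rewrite det_set_row (expand_det_row _ i) -sumrB.
under eq_bigr => j _ do rewrite -mulrBl mxE ltnn.
apply: (syzygy_cofactor i (r := fun l => B i l - B' i l)) => // [l|].
  by rewrite Mg.
by under eq_bigr do rewrite mulrBl; rewrite sumrB Bg B'g subrr.
Qed.

Lemma ideal_congr_prod_exp I (r : seq 'I_n.+1) (u v : 'I_n.+1 -> S) (m : 'I_n.+1 -> nat) :
  is_ideal I -> (forall i, I (u i - v i)) ->
  I (\prod_(i <- r) u i ^+ m i - \prod_(i <- r) v i ^+ m i).
Proof.
move=> idI Iuv.
have IM a b c d : I (a - b) -> I (c - d) -> I (a * c - b * d).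
  move=> Iab Icd; have -> : a * c - b * d = a * (c - d) + d * (a - b) by ring.
  by apply: idealD => //; apply: idealMl.
elim: r => [|i r IHr]; first by rewrite !big_nil subrr; apply: ideal0.
rewrite !big_cons; apply: (IM) => //; elim: (m i) => [|k IHk].
  by rewrite !expr0 subrr; apply: ideal0.
by rewrite !exprS; apply: IM.
Qed.

(** Modulo the linear forms X_j - (v_j / v_k) X_k, which cut out the point v, a form
    p of degree e is p(v) times the e-th power of X_k / v_k. So a form vanishing at v
    is a combination b_j X_j of the coordinates whose coefficient row also annihilates
    the vector v. *)
Lemma vanishing_row e p (v : 'I_n.+1 -> K) k :
  p \is e.-homog -> v k != 0 -> p.@[v] = 0 ->
  exists b : 'I_n.+1 -> S, \sum_j b j * 'X_j = p /\ \sum_j b j * (v j)%:MP = 0.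
Proof.
move=> hp vk pv; pose c j := v j / v k.
pose L j : S := 'X_j - c j *: 'X_k.
have [a pa] : ideal_gen L p.
  have idL := ideal_gen_ideal L.
  have -> : p = p - (p.@[v] / v k ^+ e) *: 'X_k ^+ e by rewrite pv mul0r scale0r subr0.
  rewrite {1}(mpolyE p) mevalE mulr_suml scaler_suml -sumrB.
  rewrite big_seq; apply: (ideal_sum idL) => m mp.
  rewrite -!scalerA -scalerBr scalerA -[p@_m *: _]mul_mpolyC; apply: (idealMl idL).
  have -> : (\prod_i v i ^+ m i * (v k ^+ e)^-1) *: 'X_k ^+ e =
      \prod_i (c i *: 'X_k) ^+ m i :> S.
    under [RHS]eq_bigr do rewrite exprZn.
    rewrite scaler_prod -[X in _ = _ *: X]expr_sum.
    have <- : \sum_i m i = e by have := dhomog_mf hp mp; rewrite /= mdegE.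
    congr (_ *: _); rewrite -prodrXr -prodfV -big_split /=.
    by apply: eq_bigr => i _; rewrite expr_div_n.
  rewrite mpolyXE_id; apply: ideal_congr_prod_exp => // i.
  by apply: (ideal_gen_mem L).
pose d : S := \sum_l c l *: a l.
have sum_b (x : 'I_n.+1 -> S) :
    \sum_j (a j - (j == k)%:R * d) * x j = \sum_j a j * x j - d * x k.
  under eq_bigr do rewrite mulrBl -mulrA mulr_natl.
  rewrite sumrB; congr (_ - _).
  by rewrite (bigD1 k) //= eqxx big1 ?addr0 // => l /negPf ->.
(* Column k takes the coefficients of X_k in all the linear forms L_j. *)
exists (fun j => a j - (j == k)%:R * d); rewrite !sum_b /d !mulr_suml -!sumrB.
split; first by rewrite pa; apply: eq_bigr => j _; rewrite mulrBr -scalerAl -scalerAr.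
rewrite big1 // => j _.
by rewrite mulrC mul_mpolyC mulrC mul_mpolyC scalerA mulrC divfK // subrr.
Qed.

Lemma det_row_annihilator (B : 'M[S]_n.+1) (v : 'I_n.+1 -> K) k :
  v k != 0 -> (forall i, \sum_j B i j * (v j)%:MP = 0) -> \det B = 0.
Proof.
move=> vk Bv; pose w : 'cV[S]_n.+1 := \col_j (v j)%:MP.
have Bw : B *m w = 0.
  by apply/matrixP => i j; rewrite !mxE -[RHS](Bv i); apply: eq_bigr => l _; rewrite mxE.
have : (\adj B *m (B *m w)) k 0 = \det B * (v k)%:MP.
  by rewrite mulmxA mul_adj_mx mul_scalar_mx !mxE.
rewrite Bw mulmx0 mxE => /esym/eqP; rewrite mulf_eq0 mpolyC_eq0 (negPf vk) orbF.
by move/eqP.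
Qed.

End TransitionMatrices.

(** * Ideals of sequences and of powers of the coordinates *)

Section ListIdeals.
Variable A : comNzRingType.
Implicit Types (g : seq A) (I : set A).

Fixpoint gen g : set A :=
  if g is a :: g' then fun p => exists c, gen g' (p - c * a) else fun p => p = 0.

Lemma gen_ideal g : is_ideal (gen g).
Proof.
elim: g => [|a g idg]; first by split=> [|x y -> ->|b x ->] /=; rewrite ?addr0 ?mulr0.
split=> /= [|x y [c gx] [d gy]|b x [c gx]].
- by exists 0; rewrite mul0r subr0; apply: ideal0.
- by exists (c + d); rewrite mulrDl opprD addrACA; apply: idealD.
- by exists (b * c); rewrite -mulrA -mulrBr; apply: idealMl.
Qed.

Lemma gen_behead a g p : gen g p -> gen (a :: g) p.
Proof. by exists 0; rewrite mul0r subr0. Qed.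

Lemma gen_mem g a : a \in g -> gen g a.
Proof.
elim: g => //= b g IHg; rewrite inE => /predU1P[->|/IHg ga].
  by exists 1; rewrite mul1r subrr; apply: (ideal0 (gen_ideal g)).
exact: gen_behead.
Qed.

Lemma gen_min I g p : is_ideal I -> {in g, forall a, I a} -> gen g p -> I p.
Proof.
move=> idI; elim: g p => /= [|a g IHg] p Ig; first by move=> ->; apply: ideal0.
case=> c gpc; apply: (ideal_congr idI (y := c * a)).
  by apply: IHg => // b gb; apply: Ig; rewrite inE gb orbT.
by apply: idealMl => //; apply: Ig; rewrite mem_head.
Qed.

Lemma gen_sub g g' p : {subset g <= g'} -> gen g p -> gen g' p.
Proof. by move=> gg'; apply: (gen_min (gen_ideal g')) => a /gg'; apply: gen_mem. Qed.

End ListIdeals.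

Section Powers.
Variables (K : numFieldType) (n : nat).
Local Notation S := {mpoly K[n.+1]}.
Implicit Types (p q f : S) (I : set S).

Lemma gen_powersP e (js : seq 'I_n.+1) p :
  gen [seq 'X_j ^+ e | j <- js] p <->
  {in msupp p, forall m : 'X_{1..n.+1}, has (fun j => e <= m j)%N js}.
Proof.
set g := map _ _; split.
  pose W : set S := fun p =>
    {in msupp p, forall m : 'X_{1..n.+1}, has (fun j => e <= m j)%N js}.
  apply: (@gen_min _ W g p) => [|_ /mapP[j js_j ->] m].
    split=> [m|x y Wx Wy m /msuppD_le|a x Wx m /msuppM_le].
    - by rewrite msupp0.
    - by rewrite mem_cat => /orP[/Wx|/Wy].
    - case/allpairsP => -[m1 m2] /= [_ /Wx /hasP[j js_j em] ->].
      by apply/hasP; exists j; rewrite ?mnmDE ?(leq_trans em) ?leq_addl.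
  rewrite mpolyXn msuppX inE => /eqP ->; apply/hasP; exists j => //.
  by rewrite mulmnE mnm1E eqxx mul1n.
move=> hp; rewrite [p]mpolyE big_seq; apply: (ideal_sum (gen_ideal g)) => m mp.
have /hasP[j js_j em] := hp m mp.
have -> : 'X_[m] = 'X_[m - U_(j) *+ e] * 'X_j ^+ e :> S.
  rewrite mpolyXn -mpolyXD submK //; apply/mnm_lepP => i; rewrite mulmnE mnm1E.
  by case: eqVneq => [<-|_]; rewrite ?mul1n.
rewrite -mul_mpolyC mulrA; apply/(idealMl (gen_ideal g))/gen_mem/mapP.
by exists j.
Qed.

(** Wiebe's argument. Let C be a matrix writing the powers X_j^(N+1) in terms of g.
    Multiplication by det C maps the ideal of g into the ideal of these powers. But C B
    and the diagonal matrix of the X_j^N are both transition matrices from the coordinates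
    to the powers, so det C det B is congruent to the product of the X_j^N, which is
    outside the latter ideal. *)
Lemma transition_det_notin N (B : 'M[S]_n.+1) (g : 'I_n.+1 -> S) :
  (forall i, \sum_j B i j * 'X_j = g i) ->
  (forall j, ideal_gen g ('X_j ^+ N.+1)) -> ~ ideal_gen g (\det B).
Proof.
move=> Bg /choice[c gN] [b detB].
pose C : 'M[S]_n.+1 := \matrix_(j, l) c j l.
pose I : set S := gen [seq 'X_j ^+ N.+1 | j <- enum 'I_n.+1].
have idI : is_ideal I by apply: gen_ideal.
have IN j : I ('X_j ^+ N.+1) by apply/gen_mem/map_f; rewrite mem_enum.
pose D : 'M[S]_n.+1 := diag_mx (\row_j 'X_j ^+ N).
have ICB : I (\det (C *m B) - \det D).
  apply: (@det_transition _ _ I _ _ (fun j => 'X_j ^+ N.+1)) => // l.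
    rewrite gN; under eq_bigr do rewrite mxE mulr_suml.
    rewrite exchange_big; apply: eq_bigr => i _ /=.
    by rewrite -Bg mulr_sumr; apply: eq_bigr => j _; rewrite mxE mulrA.
  rewrite (bigD1 l) //= big1 => [|j /negPf lj]; rewrite !mxE.
    by rewrite eqxx mulr1n addr0 exprSr.
  by rewrite eq_sym lj mulr0n mul0r.
have Ig l : I (\det C * g l).
  have -> : \det C * g l = (\adj C *m (C *m \col_l g l)) l 0.
    by rewrite mulmxA mul_adj_mx mul_scalar_mx !mxE.
  rewrite mxE; apply: ideal_sum => // j _; apply: idealMl => //.
  by rewrite mxE; under eq_bigr do rewrite !mxE; rewrite -gN.
have : I (\det D).
  rewrite -[\det D]opprK -[- \det D](addKr (\det (C *m B))); apply: idealN => //.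
  apply: idealD => //; apply: idealN => //; rewrite det_mulmx detB mulr_sumr.
  by apply: ideal_sum => // l _; rewrite mulrCA; apply: idealMl.
rewrite /D det_diag; under eq_bigr do rewrite mxE.
have <- : 'X_[[multinom N | i < n.+1]] = \prod_(i < n.+1) 'X_i ^+ N :> S.
  by rewrite mpolyXE_id; apply: eq_bigr => i _; rewrite mnmE.
move/gen_powersP/(_ [multinom N | i < n.+1]); rewrite msuppX inE eqxx.
by case/(_ isT)/hasP => j _; rewrite mnmE ltnn.
Qed.

End Powers.

(** * The Hessian determinant modulo the Jacobian ideal *)

Section Hessian.
Variables (R : realType) (n d : nat).
Local Notation C := (R[i]).
Local Notation S := {mpoly C[n.+1]}.
Variable f : S.
Hypothesis homf : f \is d.-homog.

Let H : 'M[S]_n.+1 := \matrix_(i, j) f^`M(i)^`M(j).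
Let g i : S := (d.-1)%:R *: f^`M(i).

Lemma hessian_transition i : \sum_j H i j * 'X_j = g i.
Proof.
rewrite /g -(euler (mderiv_homog i homf)).
by apply: eq_bigr => j _; rewrite mxE mulrC.
Qed.

Lemma jacobian_ideal_ideal : is_ideal (jacobian_ideal f).
Proof. exact: ideal_gen_ideal. Qed.

Lemma jacobian_ideal_deriv i : jacobian_ideal f (g i).
Proof.
rewrite /g -mul_mpolyC; apply: (idealMl jacobian_ideal_ideal).
exact: ideal_gen_mem.
Qed.

Lemma det_homog e (B : 'M[S]_n.+1) :
  (forall i j, B i j \is e.-homog) -> \det B \is (n.+1 * e).-homog.
Proof.
move=> hB; apply: rpred_sum => s _; rewrite mulr_sign.
suff hp : \prod_i B i (s i) \is (n.+1 * e).-homog.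
  by case: ifP; rewrite ?rpredN.
rewrite mulnC -[X in (e * X)%N]card_ord -sum1_card big_distrr /=.
elim/big_rec2: _ => [|i p k _ hk]; first exact: dhomog1.
by rewrite muln1; apply: dhomogM.
Qed.

Lemma hessian_homog : hessian f \is (n.+1 * (d - 2)).-homog.
Proof.
apply: det_homog => i j; rewrite mxE subn2.
by do 2!apply: mderiv_homog.
Qed.

(** By Cramer's rule: the Hessian matrix maps the coordinate vector to
    a multiple of the gradient. *)
Lemma mul_var_hessian j : jacobian_ideal f ('X_j * hessian f).
Proof.
have -> : 'X_j * hessian f = (\adj H *m (H *m \col_j 'X_j)) j 0.
  by rewrite mulmxA mul_adj_mx mul_scalar_mx !mxE mulrC.
rewrite mxE; apply: (ideal_sum jacobian_ideal_ideal) => l _.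
apply: (idealMl jacobian_ideal_ideal); rewrite mxE.
under eq_bigr do rewrite [(\col_j _) _ _]mxE.
by rewrite hessian_transition; apply: jacobian_ideal_deriv.
Qed.

(** At a singular point v every partial derivative vanishes, so the gradient has a
    second transition matrix, whose rows annihilate v and whose determinant is
    therefore zero. *)
Lemma hessian_singular v : (2 <= d)%N -> singular_point f v ->
  jacobian_ideal f (hessian f).
Proof.
move=> d2 [vn0 _ fv].
have /existsP[k vk] : [exists k, v 0 k != 0].
  apply: contraNT vn0; rewrite negb_exists => /forallP v0.
  by apply/eqP/rowP => k; rewrite mxE; apply/eqP; rewrite -[_ == _]negbK.
have hg i : g i \is (d.-1).-homog by apply/dhomogZ/mderiv_homog.
have gv i : (g i).@[v 0] = 0 by rewrite mevalZ fv mulr0.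
have /choice[b bP] := fun i => vanishing_row (hg i) vk (gv i).
pose B : 'M[S]_n.+1 := \matrix_(i, j) b i j.
have detB : \det B = 0.
  apply: (det_row_annihilator vk) => i.
  by under eq_bigr do rewrite mxE; case: (bP i).
rewrite -[hessian f]subr0 -detB.
apply: (det_transition jacobian_ideal_ideal jacobian_ideal_deriv hessian_transition).
by move=> i; under eq_bigr do rewrite mxE; case: (bP i).
Qed.

Lemma hessian_notin N : (2 <= d)%N ->
  (forall j, jacobian_ideal f ('X_j ^+ N.+1)) -> ~ jacobian_ideal f (hessian f).
Proof.
move=> d2 fN fH; have d0 : (d.-1)%:R != 0 :> C by rewrite pnatr_eq0; lia.
have fg p : jacobian_ideal f p -> ideal_gen g p.
  apply: ideal_gen_min => [|j]; first exact: ideal_gen_ideal.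
  have -> : f^`M(j) = (d.-1%:R^-1)%:MP * g j.
    by rewrite mul_mpolyC scalerA mulVf ?scale1r.
  by apply: idealMl; [exact: ideal_gen_ideal|exact: ideal_gen_mem].
by apply: (transition_det_notin hessian_transition (N := N)) => [j|]; apply: fg.
Qed.

End Hessian.

(** * Hilbert series of regular sequences of forms *)

Section Series.
Implicit Types (F G : fps) (p q : {poly int}).

Lemma fps_mul_coef p F N k : (k <= N)%N ->
  fps_mul (fps_poly p) F k = (p * \poly_(i < N.+1) F i)`_k.
Proof.
move=> kN; rewrite coefM; apply: eq_bigr => i _; rewrite coef_poly.
by rewrite ltnS (leq_trans (leq_subr _ _) kN).
Qed.

Lemma eq_fps_mul F G G' : G =1 G' -> fps_mul F G =1 fps_mul F G'.
Proof. by move=> GG' k; apply: eq_bigr => i _; rewrite GG'. Qed.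

Lemma fps_mulA p q F :
  fps_mul (fps_poly p) (fps_mul (fps_poly q) F) =1 fps_mul (fps_poly (p * q)) F.
Proof.
move=> k; rewrite [RHS](fps_mul_coef _ _ (leqnn k)) -mulrA coefM.
apply: eq_bigr => i _; rewrite -(@fps_mul_coef _ _ k) ?leq_subr //.
Qed.

Lemma fps_mul_poly p q : fps_mul (fps_poly p) (fps_poly q) =1 fps_poly (p * q).
Proof. by move=> k; rewrite /fps_poly coefM. Qed.

Lemma fps_mul1 F : fps_mul (fps_poly 1) F =1 F.
Proof. by move=> k; rewrite (fps_mul_coef _ _ (leqnn k)) mul1r coef_poly ltnSn. Qed.

Lemma fps_mulI p F G : p`_0 = 1 ->
  fps_mul (fps_poly p) F =1 fps_mul (fps_poly p) G -> F =1 G.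
Proof.
move=> p0 FG k; elim/ltn_ind: k => k IHk.
have := FG k; rewrite /fps_mul !big_ord_recl /= subn0 /fps_poly p0 !mul1r.
set u := \sum_(i < k) _; set v := \sum_(i < k) _; have -> : u = v.
  by apply: eq_bigr => i _; rewrite /bump IHk // /bump; have := ltn_ord i; lia.
by move/addIr.
Qed.

End Series.

Section Regular.
Variables (K : numFieldType) (n : nat).
Local Notation S := {mpoly K[n.+1]}.
Implicit Types (p q a : S) (g : seq S) (I : set S).

Definition forms e g := all (fun p => p \is e.-homog) g.

(** The sequence is read from its tail: the head is the last element adjoined. Only
    homogeneous elements are tested, which is enough for homogeneous ideals. *)
Fixpoint regular g : Prop :=
  if g is a :: g' then
    regular g' /\ forall k u, u \is k.-homog -> gen g' (u * a) -> gen g' u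
  else True.

Definition hseries g : fps := fun k => (hilbert_fun (gen g) k)%:Z.

Lemma gen_pihomog e g p k : forms e g -> gen g p -> gen g (pihomog mdeg k p).
Proof.
elim: g p => [|a g IHg] p /=; first by move=> _ ->; rewrite linear0.
case/andP=> ha hg [c gpc]; have := IHg _ hg gpc; rewrite linearB /= mulrC.
have [ek|ke] := leqP e k; last first.
  rewrite (pihomogMl_small _ ha ke) subr0; exact: gen_behead.
by rewrite -{2}(subnKC ek) (pihomogMl _ _ ha) mulrC; exists (pihomog mdeg (k - e) c).
Qed.

Lemma gen_homog_head e a g p k : forms e (a :: g) -> p \is (k + e).-homog ->
  gen (a :: g) p -> exists2 c, c \is k.-homog & gen g (p - c * a).
Proof.
move=> /andP[ha hg] hp [c gpc]; exists (pihomog mdeg k c); first exact: pihomogP.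
have := gen_pihomog (e + k) hg gpc; rewrite linearB /= mulrC (pihomogMl _ _ ha).
by rewrite pihomog_dE 1?mulrC // addnC.
Qed.

Lemma gen_small e a g p k : forms e (a :: g) -> p \is k.-homog -> (k < e)%N ->
  gen (a :: g) p -> gen g p.
Proof.
move=> /andP[ha hg] hp ke [c gpc].
have := gen_pihomog k hg gpc; rewrite linearB /= mulrC (pihomogMl_small _ ha ke).
by rewrite subr0 pihomog_dE.
Qed.

Lemma eq_hilbert_fun I I' k : is_ideal I -> is_ideal I' ->
  (forall p, p \is k.-homog -> I p <-> I' p) -> hilbert_fun I k = hilbert_fun I' k.
Proof.
move=> idI idI' II'; congr (_ - \dim _)%N; apply/vspaceP => p.
apply/idP/idP => /(mem_ideal_part _ _) hp; apply/mem_ideal_part => //.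
  by apply/(II' _ (valP p))/hp.
by apply/(II' _ (valP p))/hp.
Qed.

Definition mul_form e a (ha : a \is e.-homog) k (u : dhomog n.+1 K k) :
  dhomog n.+1 K (k + e) := DHomog (dhomogM (valP u) ha).

Lemma mul_form_linear e a (ha : a \is e.-homog) k : linear (@mul_form e a ha k).
Proof. by move=> c u v; apply: val_inj => /=; rewrite mulrDl -scalerAl. Qed.

HB.instance Definition _ e a (ha : a \is e.-homog) k :=
  GRing.isLinear.Build K _ _ _ (@mul_form e a ha k) (@mul_form_linear e a ha k).

(** Multiplication by a, from degree k to k + e, is injective modulo g and its image
    is the degree k + e part of (a) modulo g. The kernel of the multiplication by a
    before reduction modulo g lies in the ideal of g, and cancels from the count. *)
Lemma hilbert_fun_regular e a g k : forms e (a :: g) -> regular (a :: g) ->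
  (hilbert_fun (gen (a :: g)) (k + e) + hilbert_fun (gen g) k)%N =
    hilbert_fun (gen g) (k + e).
Proof.
move=> hag [_ ra]; have /andP[ha hg] := hag.
have idg := gen_ideal g; have idag := gen_ideal (a :: g).
pose phi : 'Hom(dhomog n.+1 K k, dhomog n.+1 K (k + e)) := linfun (@mul_form e a ha k).
have phiE u : mpoly_of_dhomog (phi u) = mpoly_of_dhomog u * a by rewrite lfunE.
set P := ideal_part (gen g) k; set Q := ideal_part (gen g) (k + e).
have kerP : (lker phi <= P)%VS.
  apply/subvP => u; rewrite memv_ker => /eqP phiu; apply/mem_ideal_part => //.
  by apply: (ra k); rewrite ?(valP u) // -phiE phiu; apply: ideal0.
have imP : (phi @: P = limg phi :&: Q)%VS.
  apply/vspaceP => v; rewrite memv_cap; apply/idP/andP.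
    case/memv_imgP => u /mem_ideal_part - /(_ idg) gu ->.
    rewrite memv_img ?memvf //; split=> //; apply/mem_ideal_part => //.
    by rewrite phiE; apply: idealMr.
  case=> /memv_imgP[u _ ->] /mem_ideal_part - /(_ idg); rewrite phiE => gua.
  by apply: memv_img; apply/mem_ideal_part => //; apply: ra gua; apply: valP.
have imQ : ideal_part (gen (a :: g)) (k + e) = (limg phi + Q)%VS.
  apply/vspaceP => v; apply/idP/idP.
    move/mem_ideal_part => /(_ idag) /(gen_homog_head hag (valP v))[c hc gv].
    have -> : v = phi (DHomog hc) + (v - phi (DHomog hc)) by rewrite addrC subrK.
    apply: memv_add; first by rewrite memv_img ?memvf.
    by apply/mem_ideal_part => //=; rewrite phiE.
  case/memv_addP => _ /memv_imgP[u _ ->] [w /mem_ideal_part - /(_ idg) gw ->].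
  apply/mem_ideal_part => //=; rewrite phiE; apply: (idealD idag).
    by apply: (idealMl idag); apply: gen_mem; rewrite mem_head.
  exact: gen_behead.
have d1 := limg_ker_dim phi fullv; have d2 := limg_ker_dim phi P.
have d3 := dimv_sum_cap (limg phi) Q.
rewrite capfv in d1; rewrite (capv_idPr kerP) imP in d2.
have leP := dimvS (subvf P); have leQ := dimvS (subvf Q).
have leJ := dimvS (subvf (limg phi + Q)%VS).
rewrite /hilbert_fun imQ -/P -/Q; move: d1 d2 d3 leP leQ leJ.
move: (\dim (lker phi)) (\dim (limg phi)) (\dim (limg phi + Q)) (\dim (limg phi :&: Q)).
move: (\dim P) (\dim Q) (\dim {:dhomog n.+1 K k}) (\dim {:dhomog n.+1 K (k + e)}).
lia.
Qed.

Lemma hseries_cons e a g : forms e (a :: g) -> regular (a :: g) ->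
  fps_mul (fps_poly (1 - 'X^e)) (hseries g) =1 hseries (a :: g).
Proof.
move=> hag rag k; rewrite (fps_mul_coef _ _ (leqnn k)) mulrBl mul1r coefB.
rewrite coefXnM !coef_poly ltnSn; case: ltnP => [ke|ek].
  rewrite subr0; congr (Posz _); apply: eq_hilbert_fun; [exact: gen_ideal..|].
  move=> p hp; split; [exact: gen_behead|exact: gen_small hag hp ke].
rewrite ltnS leq_subr /hseries -{1 3}(subnK ek) -(hilbert_fun_regular _ hag rag).
by rewrite PoszD addrK.
Qed.

Lemma hseries_regular e g : forms e g -> regular g ->
  fps_mul (fps_poly ((1 - 'X^e) ^+ size g)) (hseries [::]) =1 hseries g.
Proof.
elim: g => [|a g IHg] hag rag k; first by rewrite expr0 fps_mul1.
rewrite -(hseries_cons hag rag) exprS -fps_mulA; apply: eq_fps_mul => {}k.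
by case/andP: hag rag => _ hg [rg _]; apply: IHg.
Qed.

End Regular.

Section RegularPermutation.
Variables (K : numFieldType) (n e : nat).
Hypothesis e_gt0 : (0 < e)%N.
Local Notation S := {mpoly K[n.+1]}.
Implicit Types (p q a b : S) (g : seq S).

(** If u a is 0 modulo g then u is a multiple c b of b, because a is regular modulo b,
    and c a = 0 because b is regular: induction on the degree gives c = 0. Likewise
    v b = w a forces w = c b, and then v = c a. *)
Lemma regular_swap a b g : forms e [:: a, b & g] ->
  regular [:: a, b & g] -> regular [:: b, a & g].
Proof.
move=> habg [[rg rb] ra]; have /and3P[ha hb hg] := habg.
have hbg : forms e (b :: g) by rewrite /= hb.
have hag : forms e (a :: g) by rewrite /= ha.
have idg := gen_ideal g.
split; first split=> //.
  move=> k; elim/ltn_ind: k => k IHk u hu gua.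
  have gu : gen (b :: g) u by apply: (ra k) => //; apply: gen_behead.
  have [ek|ke] := leqP e k; last exact: gen_small hbg hu ke gu.
  rewrite -(subnK ek) in hu.
  have [c hc guc] := gen_homog_head hbg hu gu.
  suff gc : gen g c by apply: (ideal_congr idg guc); apply: idealMr.
  apply: (IHk (k - e)%N) => //; first by rewrite ltn_subrL e_gt0 (leq_trans e_gt0).
  apply: (rb (k - e + e)%N); first exact: dhomogM.
  have -> : c * a * b = u * a - (u - c * b) * a by rewrite mulrBl subKr mulrAC.
  by apply: idealB => //; apply: idealMr.
move=> k v hv gvb; have hvb : v * b \is (k + e).-homog by apply: dhomogM.
have [w hw gvw] := gen_homog_head hag hvb gvb.
have gw : gen (b :: g) w.
  apply: (ra k) => //; exists v.
  by rewrite -opprB; apply: idealN.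
have [ek|ke] := leqP e k; last first.
  apply: gen_behead; apply: (rb k) => //; apply: (ideal_congr idg gvw).
  by apply: idealMr => //; apply: gen_small hbg hw ke gw.
have hw' : w \is (k - e + e).-homog by rewrite subnK.
have [c hc gwc] := gen_homog_head hbg hw' gw.
exists c; apply: (rb k).
  by rewrite rpredB //; rewrite -(subnK ek); apply: dhomogM.
have -> : (v - c * a) * b = (v * b - w * a) + (w - c * b) * a.
  by rewrite !mulrBl addrA subrK mulrAC.
by apply: idealD => //; apply: idealMr.
Qed.

Lemma regular_move g1 a g2 : forms e (g1 ++ a :: g2) ->
  regular (g1 ++ a :: g2) -> regular (a :: g1 ++ g2).
Proof.
elim: g1 => //= b g1 IHg /andP[hb hg] [rg rb].
have sub1 : {subset g1 ++ a :: g2 <= a :: g1 ++ g2}.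
  by move=> x; rewrite !(mem_cat, inE) orbCA.
have sub2 : {subset a :: g1 ++ g2 <= g1 ++ a :: g2}.
  by move=> x; rewrite !(mem_cat, inE) orbCA.
apply: (@regular_swap b a).
  move: hg; rewrite /= hb /forms !all_cat /=.
  by case/and3P => -> -> ->.
split; first exact: IHg.
move=> k u hu /(gen_sub sub2) gub; apply: (gen_sub sub1).
by apply: (rb k).
Qed.

End RegularPermutation.

Section RegularPowers.
Variables (K : numFieldType) (n : nat).
Local Notation S := {mpoly K[n.+1]}.
Implicit Types (p q a b : S) (g : seq S).

Lemma forms_powers e (js : seq 'I_n.+1) : forms e [seq 'X_j ^+ e : S | j <- js].
Proof. by apply/allP => _ /mapP[j _ ->]; apply: homogX. Qed.

Lemma regular_powers e (js : seq 'I_n.+1) : uniq js ->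
  regular [seq 'X_j ^+ e : S | j <- js].
Proof.
elim: js => //= j js IHjs /andP[jjs ujs]; split; first exact: IHjs.
move=> k u _ /gen_powersP gu; apply/gen_powersP => m mu.
have /gu /hasP[i ijs] : (m + U_(j) *+ e)%MM \in msupp (u * 'X_j ^+ e).
  by rewrite mcoeff_msupp mpolyXn addmC mcoeffMX -mcoeff_msupp.
have ij : j != i by apply: contraNneq jjs => ->.
rewrite mnmDE mulmnE mnm1E (negPf ij) mul0n addn0 => ei.
by apply/hasP; exists i.
Qed.

Lemma hilbert_fun_eq0 (I : set S) k : is_ideal I ->
  hilbert_fun I k = 0%N <-> forall p, p \is k.-homog -> I p.
Proof.
move=> idI; split=> [/eqP|Ik].
  rewrite subn_eq0 => full p hp; pose q := DHomog hp.
  have /eqP partE : ideal_part I k == fullv by rewrite eqEdim subvf.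
  by apply/(mem_ideal_part q idI); rewrite partE memvf.
apply/eqP; rewrite subn_eq0; apply/dimvS/subvP => p _.
by apply/mem_ideal_part => //; apply: Ik; apply: valP.
Qed.

Lemma hseries_vars : hseries [seq 'X_j ^+ 1 : S | j <- enum 'I_n.+1] =1 fps_poly 1.
Proof.
set g := map _ _; have idg := gen_ideal g; move=> k; rewrite /hseries /fps_poly coef1.
have [->|k_gt0] := posnP k; last first.
  congr (Posz _); apply/hilbert_fun_eq0 => // p hp; apply/gen_powersP => m mp.
  have /= mk := dhomog_mf hp mp.
  have /existsP[j mj] : [exists j, 0 < m j]%N.
    apply: contraLR k_gt0; rewrite negb_exists -leqNgt => /forallP m0.
    rewrite -mk mdegE big1 // => i _; apply/eqP.
    by rewrite -leqn0 leqNgt.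
  by apply/hasP; exists j; rewrite ?mem_enum.
congr (Posz _); apply/esym.
apply: (@hilbert_fun_basis _ _ _ 0 1 [tuple DHomog (dhomog1 _ mdeg)]) => //.
- move=> c; rewrite big_ord1 => g1 i; rewrite ord1; apply/eqP; apply: contraT => c0.
  move/gen_powersP/(_ 0%MM): g1; rewrite mcoeff_msupp /= linearZ /= mcoeff1 eqxx.
  by rewrite mulr1 => /(_ c0) /hasP[j _]; rewrite mnm0E.
- move=> p; exists (fun=> (val p)@_0); rewrite big_ord1 /=.
  have -> : val p - (val p)@_0 *: 1 = 0; last exact: ideal0.
  apply/mpolyP => m; rewrite mcoeffB mcoeffZ mcoeff1 mcoeff0.
  case: eqVneq => [->|m0]; first by rewrite mulr1 subrr.
  by rewrite mulr0 subr0 (dhomog_nemf_coeff (valP p)) // mdeg_eq0.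
Qed.

(** The Hilbert series of S satisfies (1 - t)^(n+1) HP(S) = 1 because the coordinates
    themselves form a regular sequence with quotient K. *)
Lemma hseries_complete_intersection e g : forms e g -> regular g ->
  fps_mul (fps_poly ((1 - 'X) ^+ n.+1)) (hseries g) =1 fps_poly ((1 - 'X^e) ^+ size g).
Proof.
move=> hg rg k.
have hv : fps_mul (fps_poly ((1 - 'X) ^+ n.+1)) (hseries ([::] : seq S)) =1 fps_poly 1.
  move=> {}k; rewrite -hseries_vars.
  rewrite -(hseries_regular (forms_powers _ _) (regular_powers _ (enum_uniq _))).
  by rewrite size_map size_enum_ord expr1.
rewrite -(eq_fps_mul _ (hseries_regular hg rg)) fps_mulA mulrC -fps_mulA.
by rewrite (eq_fps_mul _ hv) fps_mul_poly mulr1.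
Qed.

(** The Hilbert series is the polynomial (1 + t + ... + t^(e-1))^(n+1), of degree
    (n + 1)(e - 1). *)
Lemma regular_full e g k p : forms e g -> regular g -> size g = n.+1 ->
  (n.+1 * e.-1 < k)%N -> p \is k.-homog -> gen g p.
Proof.
move=> hg rg sg nk; apply: (iffLR (hilbert_fun_eq0 k (gen_ideal g))) => {p}.
pose q : {poly int} := \sum_(i < e) 'X^i.
suff /(_ k) : hseries g =1 fps_poly (q ^+ n.+1).
  rewrite /hseries /fps_poly nth_default; first by case.
  apply: leq_trans nk; apply: (leq_trans (size_poly_exp_leq _ _)).
  rewrite ltnS mulnC leq_mul2l /=.
  have -> : q = \poly_(i < e) 1 by rewrite poly_def; apply: eq_bigr => i _; rewrite scale1r.
  by rewrite -!subn1 leq_sub2r ?size_poly ?orbT.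
apply: (@fps_mulI ((1 - 'X) ^+ n.+1)).
  by rewrite -horner_coef0 !hornerE ?subr0 expr1n.
move=> {nk}k; rewrite (hseries_complete_intersection hg rg) fps_mul_poly sg -exprMn.
by have -> : (1 - 'X) * q = 1 - 'X^e by rewrite -[1 - 'X]opprB mulNr -subrX1 opprB.
Qed.

End RegularPowers.

(** * Multiplication matrices and exchange *)

Lemma complement_basis (K : fieldType) (V : vectType K) (Q : {vspace V}) :
  exists D, exists E : 'I_D -> V,
    (forall c : 'I_D -> K, \sum_i c i *: E i \in Q -> forall i, c i = 0) /\
    (forall v, exists c : 'I_D -> K, v - \sum_i c i *: E i \in Q).
Proof.
pose b := vbasis Q^C; have bQ : basis_of Q^C b by apply: vbasisP.
exists (\dim Q^C); exists (fun i => b`_i); split=> [c cQ|v].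
  have : \sum_i c i *: b`_i \in (Q :&: Q^C)%VS.
    rewrite memv_cap cQ; apply: rpred_sum => i _; apply: rpredZ.
    by apply: (basis_mem bQ); rewrite mem_nth ?size_tuple.
  rewrite capv_compl memv0 => /eqP c0.
  by move/freeP: (basis_free bQ); apply.
have /memv_addP[q qQ [w wQ ->]] : v \in (Q + Q^C)%VS by rewrite addv_complf memvf.
exists (fun i => coord b i w).
by rewrite -(coord_basis bQ wQ) addrK.
Qed.

Section Triangular.
Variables (K : fieldType) (D : nat).
Implicit Types A B : 'M[K]_D.

Lemma mxE_linear k A B i j : (k *: A + B) i j = k * A i j + B i j.
Proof. by rewrite !mxE. Qed.

Lemma trig_mulmx A B : is_trig_mx A -> is_trig_mx B -> is_trig_mx (A *m B).
Proof.
move=> /is_trig_mxP hA /is_trig_mxP hB; apply/is_trig_mxP => i j ij.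
rewrite mxE big1 // => l _; have [il|li] := ltnP i l; first by rewrite hA ?mul0r.
by rewrite hB ?mulr0 // (leq_ltn_trans li).
Qed.

Lemma trig_mulmx_diag A B i : is_trig_mx A -> is_trig_mx B ->
  (A *m B) i i = A i i * B i i.
Proof.
move=> /is_trig_mxP hA /is_trig_mxP hB; rewrite mxE (bigD1 i) //= big1 ?addr0 //.
move=> l lni; have [il|li] := ltnP i l; first by rewrite hA ?mul0r.
by rewrite hB ?mulr0 // ltn_neqAle lni.
Qed.

End Triangular.

Section Multiplication.
Variables (K : numClosedFieldType) (n e : nat).
Hypothesis e_gt0 : (0 < e)%N.
Local Notation S := {mpoly K[n.+1]}.
Variables (g : seq S) (D : nat) (E : 'I_D -> S) (j : 'I_n.+1).
Let a : S := 'X_j ^+ e.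
Let comb (c : 'I_D -> K) : S := \sum_l c l *: E l.
Hypothesis E_free : forall m c, gen g (a ^+ m * comb c) -> forall l, c l = 0.
Hypothesis E_span : forall q, q \is e.-homog ->
  forall i, exists c, gen g (q * E i - a * comb c).

(** T is the matrix of q / a^m acting on the span of the E_i modulo g. *)
Definition represents m q (T : 'M[K]_D) :=
  forall i, gen g (q * E i - a ^+ m * comb (T i)).

Let idg : is_ideal (gen g) := gen_ideal g.

Lemma comb_linear k (c d : 'I_D -> K) : comb (fun l => k * c l + d l) = k *: comb c + comb d.
Proof.
rewrite /comb scaler_sumr -big_split; apply: eq_bigr => l _ /=.
by rewrite scalerDl scalerA.
Qed.

Lemma represents_comb m q T c : represents m q T ->
  gen g (q * comb c - a ^+ m * comb (fun l => \sum_i c i * T i l)).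
Proof.
move=> qT.
have -> : comb (fun l => \sum_i c i * T i l) = \sum_i c i *: comb (T i).
  rewrite /comb; under eq_bigr do rewrite scaler_suml.
  rewrite exchange_big; apply: eq_bigr => i _ /=.
  by rewrite scaler_sumr; apply: eq_bigr => l _; rewrite scalerA.
rewrite /comb !mulr_sumr -sumrB; apply: ideal_sum => // i _.
by rewrite -!scalerAr -scalerBr -mul_mpolyC; apply: idealMl.
Qed.

Lemma represents_uniq m q T T' : represents m q T -> represents m q T' -> T = T'.
Proof.
move=> qT qT'; apply/matrixP => i l; apply/eqP; rewrite -subr_eq0; apply/eqP.
move: l; apply: (E_free (m := m)).
have -> : comb (fun l => T i l - T' i l) = comb (T i) - comb (T' i).
  rewrite /comb -sumrB; apply: eq_bigr => l _; exact: scalerBl.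
have -> : a ^+ m * (comb (T i) - comb (T' i)) =
    (q * E i - a ^+ m * comb (T' i)) - (q * E i - a ^+ m * comb (T i)).
  by rewrite mulrBr opprB [RHS]addrC addrA subrK.
by apply: idealB.
Qed.

Lemma represents_mul m q T m' q' T' : represents m q T -> represents m' q' T' ->
  represents (m + m') (q * q') (T *m T').
Proof.
move=> qT qT' i; apply: (ideal_congr idg (y := q' * (q * E i - a ^+ m * comb (T i)) +
    a ^+ m * (q' * comb (T i) - a ^+ m' * comb (fun l => \sum_k T i k * T' k l)))).
  have -> : comb ((T *m T') i) = comb (fun l => \sum_k T i k * T' k l).
    by apply: eq_bigr => l _; rewrite mxE.
  set u := comb _; set v := comb _; rewrite exprD.
  have -> : q * q' * E i - a ^+ m * a ^+ m' * u -
      (q' * (q * E i - a ^+ m * v) + a ^+ m * (q' * v - a ^+ m' * u)) = 0.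
    rewrite !mulrBr !mulrA [q' * q]mulrC [q' * a ^+ m]mulrC.
    by rewrite addrA subrK subrr.
  exact: ideal0.
by apply: idealD => //; apply: idealMl => //; apply: represents_comb.
Qed.

Lemma represents_linear m k q T q' T' : represents m q T -> represents m q' T' ->
  represents m (k *: q + q') (k *: T + T').
Proof.
move=> qT qT' i.
have -> : comb ((k *: T + T') i) = k *: comb (T i) + comb (T' i).
  by rewrite -comb_linear; apply: eq_bigr => l _; rewrite !mxE.
rewrite mulrDl mulrDr opprD addrACA; apply: idealD => //.
by rewrite -scalerAl -scalerAr -scalerBr -mul_mpolyC; apply: idealMl.
Qed.

Lemma represents0 m : represents m 0 0.
Proof.
move=> i; rewrite mul0r sub0r; apply: idealN => //; apply: idealMl => //.
by rewrite /comb big1 => [|l _]; [exact: ideal0|rewrite mxE scale0r].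
Qed.

Lemma represents1 : represents 0 1 1%:M.
Proof.
move=> i; have -> : comb (1%:M i) = E i.
  rewrite /comb (bigD1 i) //= mxE eqxx scale1r big1 ?addr0 // => l /negPf li.
  by rewrite mxE eq_sym li scale0r.
by rewrite expr0 subrr; apply: ideal0.
Qed.

Lemma represents_divisor : represents 1 a 1%:M.
Proof.
move=> i; have := represents1 i; rewrite expr0 expr1 !mul1r -mulrBr => gE.
by apply: idealMl.
Qed.

(** The matrices of X_i X_j^(e-1) / X_j^e commute, hence are simultaneously triangular
    in some basis. The l-th diagonal entries form a point p_l with p_l(j) = 1, and the
    l-th diagonal entry of any q / X_j^(em) is then q(p_l): geometrically
    the p_l are the points of V(g) in projective space, repeated with multiplicity. *)
Lemma triangular_multiplication : exists p : 'I_D -> 'I_n.+1 -> K,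
  (forall l, p l j = 1) /\
  (forall q, q \is e.-homog -> exists2 T, represents e (q * a ^+ e.-1) T &
     \det T = \prod_l q.@[p l]).
Proof.
pose y i : S := 'X_i * 'X_j ^+ e.-1.
have yhom i : y i \is e.-homog.
  have := dhomogM (homogXi K i) (homogX K e.-1 j).
  by rewrite add1n prednK.
have /choice[Y YP] i : exists T, represents 1 (y i) T.
  have /choice[c cP] := E_span (yhom i).
  exists (\matrix_(k, l) c k l) => k; rewrite expr1.
  suff -> : comb ((\matrix_(k, l) c k l) k) = comb (c k) by [].
  by apply: eq_bigr => l _; rewrite mxE.
have Ycomm : {in [seq Y i | i <- enum 'I_n.+1] &, forall A B, comm_mx A B}.
  move=> _ _ /mapP[i _ ->] /mapP[k _ ->]; apply: (@represents_uniq 2 (y i * y k)).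
    exact: represents_mul (YP i) (YP k).
  by rewrite mulrC; apply: represents_mul (YP k) (YP i).
have [P /unitarymx_unit Pu /allP Ptrig] := cotrigonalization Ycomm.
pose cj T := P *m T *m invmx P.
have cjM T T' : cj (T *m T') = cj T *m cj T' by rewrite /cj !mulmxA mulmxKV.
have cj1 : cj 1%:M = 1%:M by rewrite /cj mulmx1 mulmxV.
pose p l i := cj (Y i) l l.
have pj l : p l j = 1.
  have -> : p l j = cj 1%:M l l; last by rewrite cj1 mxE eqxx.
  congr (cj _ l l); apply: (@represents_uniq 1 (y j)) => //.
  by rewrite /y -exprS prednK //; apply: represents_divisor.
exists p; split=> //.
(* Both conditions are multiplicative in q because triangular matrices multiply
   diagonally. *)
pose good m q := exists T, [/\ represents m q T, is_trig_mx (cj T) &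
  forall l, cj T l l = q.@[p l]].
have good_mul m q m' q' : good m q -> good m' q' -> good (m + m')%N (q * q').
  case=> [T [qT tT dT]] [T' [qT' tT' dT']]; exists (T *m T'); rewrite cjM.
  split=> [||l]; [exact: represents_mul|exact: trig_mulmx|].
  by rewrite trig_mulmx_diag // dT dT' mevalM.
have good1 : good 0%N 1.
  exists 1%:M; rewrite cj1; split=> [||l]; first exact: represents1.
    exact: scalar_mx_is_trig.
  by rewrite meval1 mxE eqxx.
have good_lin m k q q' : good m q -> good m q' -> good m (k *: q + q').
  case=> [T [qT tT dT]] [T' [qT' tT' dT']]; exists (k *: T + T').
  have -> : cj (k *: T + T') = k *: cj T + cj T'.
    by rewrite /cj mulmxDr mulmxDl -scalemxAr -scalemxAl.
  split=> [||l]; first exact: represents_linear.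
    move/is_trig_mxP: tT => tT; move/is_trig_mxP: tT' => tT'.
    by apply/is_trig_mxP => u v uv; rewrite mxE_linear tT // tT' // mulr0 addr0.
  by rewrite mevalD mevalZ -dT -dT' mxE_linear.
have good0 m : good m 0.
  exists 0; split=> [||l]; first exact: represents0.
    by rewrite /cj mulmx0 mul0mx mx0_is_trig.
  by rewrite /cj mulmx0 mul0mx meval0 mxE.
have good_y i : good 1%N (y i).
  exists (Y i); split=> [||l]; first exact: YP.
    rewrite /cj -conjumx //; apply: Ptrig; apply: map_f; exact: mem_enum.
  by rewrite /y mevalM mevalXU rmorphXn /= mevalXU pj expr1n mulr1.
have good_exp i k : good k (y i ^+ k).
  elim: k => [|k IHk]; first by rewrite expr0.
  by rewrite exprS -add1n; apply: good_mul.
have good_q q : q \is e.-homog -> good e (q * a ^+ e.-1).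
  move=> hq; rewrite {1}(mpolyE q) mulr_suml big_seq.
  elim/big_rec: _ => [|m r mq gr]; first exact: good0.
  rewrite -scalerAl; apply: good_lin => //.
  have me : \sum_i m i = e by have := dhomog_mf hq mq; rewrite /= mdegE.
  (* A monomial of degree e is a product of e of the y_i, up to powers of X_j: this is
     where the extra factor a^(e-1) of the statement comes from. *)
  have -> : 'X_[m] * a ^+ e.-1 = \prod_i y i ^+ m i.
    rewrite /y; under [RHS]eq_bigr do rewrite exprMn.
    by rewrite big_split /= -mpolyXE_id prodrXr me /a -!exprM mulnC.
  rewrite -[in good e _]me; elim/big_rec2: _ => // i k r' _ gr'.
  exact: good_mul.
move=> q /good_q[T [qT tT dT]]; exists T => //.
have -> : \det T = \det (cj T).
  by rewrite /cj !det_mulmx mulrAC -det_mulmx mulmxV // det1 mul1r.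
rewrite det_trig //; apply: eq_bigr => l _.
by rewrite dT mevalM /a !rmorphXn /= mevalXU pj !expr1n mulr1.
Qed.

End Multiplication.

Lemma exists_nonroot (K : numDomainType) (h : {poly K}) (bad : seq K) :
  h != 0 -> exists2 s, s \notin bad & ~~ root h s.
Proof.
move=> h0; pose q := h * \prod_(b <- bad) ('X - b%:P).
have q0 : q != 0 by rewrite mulf_neq0 // monic_neq0 ?monic_prod_XsubC.
have [/(max_poly_roots q0) qle|] :=
  boolP (all (root q) [seq k%:R | k <- iota 0 (size q)]).
  have := qle _; rewrite size_map size_iota ltnn => absurd; suff: false by [].
  by apply: absurd; rewrite map_inj_uniq ?iota_uniq // => k l /eqP; rewrite eqr_nat => /eqP.
case/allPn => _ /mapP[k _ ->]; rewrite rootM root_prod_XsubC negb_or => /andP[hk kbad].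
by exists k%:R.
Qed.

Section Exchange.
Variables (K : numClosedFieldType) (n e : nat).
Hypothesis e_gt0 : (0 < e)%N.
Local Notation S := {mpoly K[n.+1]}.
Variable F : 'I_n.+1 -> S.
Hypothesis homF : forall i, F i \is e.-homog.
Implicit Types (g : seq S) (p q : S).

Definition pencil (s : K) : S := \sum_(i < n.+1) s ^+ i *: F i.

Lemma pencil_homog s : pencil s \is e.-homog.
Proof. by apply: rpred_sum => i _; apply/dhomogZ/homF. Qed.

Lemma regular_cancel_exp g a k u m : regular (a :: g) -> a \is e.-homog ->
  u \is k.-homog -> gen g (u * a ^+ m) -> gen g u.
Proof.
move=> [_ ra] ha hu; elim: m => [|m IHm]; first by rewrite mulr1.
rewrite exprSr mulrA => gu; apply: IHm; apply: ra gu.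
exact: dhomogM hu (dhomogMn m ha).
Qed.

(** R = S/(g) is one-dimensional with the parameter X_j^e, so that R_k for large k is a
    fixed vector space on which every form of degree e acts, after division by X_j^e,
    with eigenvalues its values at the points of the finite scheme V(g). A member of
    the pencil that vanishes at none of these points acts invertibly and is therefore
    a nonzerodivisor too. *)
Lemma exchange g (j : 'I_n.+1) (bad : seq K) :
  forms e ('X_j ^+ e :: g) -> regular ('X_j ^+ e :: g) -> size g = n ->
  (forall v : 'I_n.+1 -> K, v j = 1 -> exists i, (F i).@[v] != 0) ->
  exists2 s, s \notin bad & regular (pencil s :: g).
Proof.
move=> hag rag sg nozero; set a := 'X_j ^+ e in hag rag.
have ha : a \is e.-homog by apply: homogX.
have idg := gen_ideal g; pose k0 := (n.+1 * e.-1).+1.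
have full k p : (k0 <= k)%N -> p \is k.-homog -> gen (a :: g) p.
  by move=> k0k hp; apply: (regular_full hag rag _ k0k hp); rewrite /= sg.
have [D [E0 [E0_free E0_span]]] := complement_basis (ideal_part (gen g) k0).
pose E i : S := E0 i.
have combE c : \sum_l c l *: E l = mpoly_of_dhomog (\sum_l c l *: E0 l).
  by rewrite linear_sum; apply: eq_bigr => l _; rewrite linearZ.
have comb_homog c : \sum_l c l *: E l \is k0.-homog by rewrite combE; apply: valP.
have E_free m (c : 'I_D -> K) :
    gen g (a ^+ m * \sum_l c l *: E l) -> forall l, c l = 0.
  rewrite mulrC => /(regular_cancel_exp rag ha (comb_homog c)); rewrite combE => gc.
  by apply: E0_free; apply/mem_ideal_part.
have span m v : v \is (k0 + m * e).-homog ->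
    exists c : 'I_D -> K, gen g (v - a ^+ m * \sum_l c l *: E l).
  elim: m v => [|m IHm] v hv.
    rewrite mul0n addn0 in hv; have [c] := E0_span (DHomog hv).
    by move/mem_ideal_part => /(_ idg) /=; exists c; rewrite mul1r combE.
  rewrite mulSn addnCA addnC in hv.
  have gv : gen (a :: g) v by apply: full hv; rewrite -addnA leq_addr.
  have [w hw gvw] := gen_homog_head hag hv gv; have [c gwc] := IHm w hw.
  exists c; have -> : v - a ^+ m.+1 * (\sum_l c l *: E l) =
      (v - w * a) + a * (w - a ^+ m * \sum_l c l *: E l).
    by rewrite mulrBr exprS mulrA [a * w]mulrC addrA subrK.
  by apply: idealD => //; apply: idealMl.
have E_span q : q \is e.-homog -> forall i,
    exists c : 'I_D -> K, gen g (q * E i - a * \sum_l c l *: E l).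
  move=> hq i; have [|c] := span 1%N (q * E i); last by rewrite expr1; exists c.
  by rewrite mul1n addnC; apply: dhomogM => //; apply: valP.
have [p [pj rep]] := triangular_multiplication e_gt0 E_free E_span.
pose h l : {poly K} := \poly_(i < n.+1) (F (inord i)).@[p l].
have hE l s : (h l).[s] = (pencil s).@[p l].
  rewrite horner_poly /pencil linear_sum; apply: eq_bigr => i _ /=.
  by rewrite mevalZ inord_val mulrC.
have h0 l : h l != 0.
  have [i Fi] := nozero (p l) (pj l); apply: contraNneq Fi => hl0.
  by have := congr1 (fun q : {poly K} => q`_i) hl0; rewrite coef_poly ltn_ord inord_val coef0 => ->.
have [|s sbad] := @exists_nonroot K (\prod_l h l) bad; first exact/prodf_neq0.
rewrite /root horner_prod => /prodf_neq0 hs; exists s => //.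
split=> [|k u hu gub]; first by case: rag.
have [T bT detT] := rep _ (pencil_homog s).
have Tu : T \in unitmx.
  by rewrite unitmxE detT unitfE; apply/prodf_neq0 => l _; rewrite -hE hs.
have kke : (k <= k0 + k * e)%N by rewrite (leq_trans (leq_pmulr k e_gt0)) ?leq_addl.
(* Multiplying u by X_j^t brings it to a degree congruent to k0 modulo e, where it is
   expressed in the basis E. *)
pose t := (k0 + k * e - k)%N.
have hut : u * 'X_j ^+ t \is (k0 + k * e).-homog.
  by rewrite -(subnKC kke); apply: dhomogM => //; apply: homogX.
have [c gc] := span _ _ hut; set v := \sum_l _ in gc.
have cT : forall l, \sum_i c i * T i l = 0.
  apply: (E_free (e + k)%N); set w := \sum_l _.
  have gw : gen g (pencil s * a ^+ e.-1 * v - a ^+ e * w) by apply: represents_comb.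
  (* a^k w is what multiplication by the pencil member makes of v, up to powers of a,
     and v stands for the multiple u X_j^t of u. *)
  have -> : a ^+ (e + k) * w = (u * pencil s) * (a ^+ e.-1 * 'X_j ^+ t)
      - (pencil s * a ^+ e.-1) * (u * 'X_j ^+ t - a ^+ k * v)
      - a ^+ k * (pencil s * a ^+ e.-1 * v - a ^+ e * w).
    have id (x b y z A B V W : S) : (B * A) * W =
        (x * b) * (y * z) - (b * y) * (x * z - A * V) - A * (b * y * V - B * W).
      by clear; ring.
    by rewrite exprD; apply: id.
  by apply: idealB; rewrite //; [apply: idealB|]; rewrite //;
     [apply: idealMr|apply: idealMl|apply: idealMl].
have c0 l : c l = 0.
  have /(congr1 (mulmx^~ (invmx T))) : \row_i c i *m T = 0.
    apply/rowP => i; rewrite !mxE -[RHS](cT i).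
    by apply: eq_bigr => q _; rewrite mxE.
  by rewrite mulmxK // mul0mx => /rowP/(_ l); rewrite !mxE.
have gut : gen g (u * 'X_j ^+ t).
  move: gc; rewrite /v big1 => [|l _]; first by rewrite mulr0 subr0.
  by rewrite c0 scale0r.
apply: (regular_cancel_exp (m := t) rag ha hu).
by rewrite /a -exprM -(prednK e_gt0) mulSn exprD mulrA; apply: idealMr.
Qed.

Hypothesis nozero : forall (v : 'I_n.+1 -> K) k, v k != 0 -> exists i, (F i).@[v] != 0.

Lemma exchange_all (js : seq 'I_n.+1) (ss : seq K) : uniq ss ->
  (size ss + size js)%N = n.+1 ->
  regular ([seq pencil s | s <- ss] ++ [seq 'X_j ^+ e | j <- js]) ->
  exists ss', [/\ uniq ss', size ss' = n.+1 & regular [seq pencil s | s <- ss']].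
Proof.
elim: js ss => [|j js IHjs] ss uss.
  by rewrite addn0 cats0 => sss rss; exists ss.
rewrite /= addnS => -[sz]; set g1 := map _ ss; set g2 := map _ js => rg.
have hg : forms e (g1 ++ 'X_j ^+ e :: g2).
  rewrite /forms all_cat; apply/andP; split; last exact: (forms_powers K e (j :: js)).
  by apply/allP => _ /mapP[s _ ->]; apply: pencil_homog.
have hag : forms e ('X_j ^+ e :: g1 ++ g2).
  by move: hg; rewrite /forms /= !all_cat /= andbCA.
have [|v vj|s sss rs] := exchange ss hag (regular_move e_gt0 hg rg).
- by rewrite size_cat !size_map.
- by apply: (nozero (k := j)); rewrite vj oner_eq0.
apply: (IHjs (s :: ss)); rewrite //= ?sss //.
by rewrite addSn sz.
Qed.

(** The distinct parameters make the matrix of the pencil members in terms of the F_i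
    a Vandermonde matrix, hence invertible. *)
Lemma pencil_ideal (ss : seq K) p : uniq ss -> size ss = n.+1 ->
  gen [seq pencil s | s <- ss] p <-> ideal_gen F p.
Proof.
move=> uss sss; have idF := ideal_gen_ideal F; have idp := gen_ideal [seq pencil s | s <- ss].
split.
  apply: (gen_min idF) => _ /mapP[s _ ->]; apply: (ideal_sum idF) => i _.
  by rewrite -mul_mpolyC; apply: (idealMl idF); apply: ideal_gen_mem.
apply: (ideal_gen_min idp) => i.
pose V := Vandermonde n.+1 (\row_(l < n.+1) ss`_l).
have Vu : V \in unitmx.
  rewrite unitmxE det_Vandermonde unitfE; apply/prodf_neq0 => l _.
  apply/prodf_neq0 => k lk; rewrite !mxE subr_eq0 nth_uniq ?sss //.
  by rewrite gtn_eqF.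
have -> : F i = \sum_l (invmx V l i)%:MP * pencil ss`_l.
  under eq_bigr => l _ do rewrite mul_mpolyC scaler_sumr.
  rewrite exchange_big /=.
  have /matrixP Vi := mulmxV Vu.
  have Fk (k : 'I_n.+1) : \sum_(l < n.+1) invmx V l i *: (ss`_l ^+ k *: F k) = (k == i)%:R *: F k.
    under eq_bigr do rewrite scalerA; rewrite -scaler_suml; congr (_ *: _).
    have := Vi k i; rewrite !mxE => <-; apply: eq_bigr => l _.
    by rewrite !mxE mulrC.
  under eq_bigr do rewrite Fk.
  by rewrite (bigD1 i) //= eqxx scale1r big1 ?addr0 // => k /negPf ->; rewrite scale0r.
apply: ideal_sum => // l _; apply: idealMl => //; apply: gen_mem.
by apply: map_f; rewrite mem_nth ?sss.
Qed.

Lemma complete_intersection : exists g, [/\ forms e g, size g = n.+1, regular g &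
  forall p, gen g p <-> ideal_gen F p].
Proof.
have [|//|ss [uss sss rss]] := @exchange_all (enum 'I_n.+1) [::] isT.
- by rewrite size_enum_ord.
- exact: (regular_powers _ _ (enum_uniq _)).
exists [seq pencil s | s <- ss]; split=> //.
- by apply/allP => _ /mapP[s _ ->]; apply: pencil_homog.
- by rewrite size_map.
- by move=> p; apply: pencil_ideal.
Qed.

End Exchange.

(** * Hilbert series of the Milnor algebra modulo the Hessian *)

Section MilnorAlgebra.
Variables (R : realType) (n d : nat).
Local Notation C := (R[i]).
Local Notation S := {mpoly C[n.+1]}.
Variable f : S.
Hypotheses (d_ge2 : (2 <= d)%N) (homf : f \is d.-homog).
Let T := (n.+1 * (d - 2))%N.

(** By Euler's identity f vanishes wherever its gradient does. *)
Lemma smooth_nozero (v : 'I_n.+1 -> C) k : smooth_hypersurface f -> v k != 0 ->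
  exists i, (f^`M(i)).@[v] != 0.
Proof.
move=> smooth vk; apply: contrapT => /forallNP nz.
have fv i : (f^`M(i)).@[v] = 0 by apply/eqP; rewrite -[_ == _]negbK; apply/negP/nz.
have evE (p : S) : p.@[(\row_j v j) 0] = p.@[v] by apply: meval_eq => j; rewrite mxE.
apply: (smooth (\row_j v j)); split=> [||i]; last by rewrite evE.
  by apply: contraNneq vk => /rowP/(_ k); rewrite !mxE => ->.
have := congr1 (meval v) (euler homf); rewrite evE linear_sum /= mevalZ big1 => [|i _].
  by move/esym/eqP; rewrite mulf_eq0 pnatr_eq0 -leqn0 leqNgt ltnW //= => /eqP.
by rewrite mevalM fv mulr0.
Qed.

(** Multiples of h by forms of positive degree lie in J already. *)
Lemma jacobian_hessian_idealP p : jacobian_hessian_ideal f p <->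
  exists c : C, jacobian_ideal f (p - c *: hessian f).
Proof.
have idJ := jacobian_ideal_ideal f; split=> [[q [_ [Jq [a ->] ->]]]|[c Jp]]; last first.
  exists (p - c *: hessian f), (c *: hessian f); split; rewrite ?subrK //.
  by exists (fun=> c%:MP); rewrite (big_pred1 tt) ?mul_mpolyC // => -[].
have -> : \sum_j a j * hessian f = a tt * hessian f.
  by rewrite (big_pred1 tt) // => -[].
exists (a tt)@_0; rewrite -addrA; apply: idealD => //.
move: (a tt) => {}a; rewrite -mul_mpolyC -mulrBl.
rewrite {1}[a]mpolyE mulrBl mulr_suml.
have h_lin m : m != 0%MM -> jacobian_ideal f (a@_m *: 'X_[m] * hessian f).
  move=> m0; have /existsP[i mi] : [exists i, m i != 0%N].
    apply: contraNT m0; rewrite negb_exists => /forallP m0.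
    by apply/eqP/mnmP => i; rewrite mnm0E; apply/eqP; rewrite -[_ == _]negbK.
  have -> : 'X_[m] = 'X_[m - U_(i)] * 'X_i :> S.
    rewrite -mpolyXD submK //; apply/mnm_lepP => k; rewrite mnm1E.
    by case: eqVneq => // <-; rewrite lt0n.
  by rewrite -mul_mpolyC -!mulrA; do 2!apply: idealMl => //; apply: mul_var_hessian homf _.
have [a0|a0] := boolP (0%MM \in msupp a).
  rewrite (bigD1_seq 0%MM) //= ?msupp_uniq // mpolyX0 -mul_mpolyC mulr1 addrAC subrr add0r.
  by apply: ideal_sum.
rewrite memN_msupp_eq0 // mpolyC0 mul0r subr0 big_seq; apply: ideal_sum => // m ma.
by apply: h_lin; apply: contraNneq a0 => <-.
Qed.

Lemma HP_H_hessian_in : jacobian_ideal f (hessian f) -> HP_H f =1 HP_M f.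
Proof.
move=> Jh k; congr (Posz _); have idJ := jacobian_ideal_ideal f.
apply: eq_hilbert_fun => //; first exact: ideal_add_ideal (ideal_gen_ideal _).
move=> p _; rewrite jacobian_hessian_idealP; split=> [[c Jp]|Jp].
  by apply: (ideal_congr idJ Jp); rewrite -mul_mpolyC; apply: idealMl.
by exists 0; rewrite scale0r subr0.
Qed.

Lemma jacobian_pihomog k p : jacobian_ideal f p -> jacobian_ideal f (pihomog mdeg k p).
Proof.
have hF : forms d.-1 (codom (fun i => f^`M(i))).
  by apply/allP => _ /codomP[i ->]; apply: mderiv_homog.
have eqJ q : gen (codom (fun i => f^`M(i))) q <-> jacobian_ideal f q.
  split; first apply: (gen_min (jacobian_ideal_ideal f)) => _ /codomP[i ->].
    exact: ideal_gen_mem.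
  by apply: (ideal_gen_min (gen_ideal _)) => i; apply: gen_mem; apply: codom_f.
by move/eqJ => gp; apply/eqJ; apply: gen_pihomog hF gp.
Qed.

Lemma HP_H_hessian_notin : ~ jacobian_ideal f (hessian f) ->
  HP_H f =1 HP_M f \- fps_poly 'X^T.
Proof.
move=> nJh k; rewrite /= /HP_H /HP_M /HP /fps_poly coefXn.
have idJ := jacobian_ideal_ideal f; have hh := hessian_homog homf.
have idJH : is_ideal (jacobian_hessian_ideal f).
  exact: ideal_add_ideal (ideal_gen_ideal _).
have [->|kT] := eqVneq k T; last first.
  rewrite subr0; congr (Posz _); apply: eq_hilbert_fun => // p hp.
  rewrite jacobian_hessian_idealP; split=> [[c Jp]|Jp]; last first.
    by exists 0; rewrite scale0r subr0.
  have := jacobian_pihomog k Jp; rewrite linearB linearZ /= pihomog_dE //.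
  by rewrite (pihomog_ne0 _ hh) 1?eq_sym // scaler0 subr0.
pose h := DHomog hh; set J := ideal_part (jacobian_ideal f) T.
have hJ : h \notin J by apply/negP => /mem_ideal_part - /(_ idJ).
have JH : ideal_part (jacobian_hessian_ideal f) T = (J + <[h]>)%VS.
  apply/vspaceP => p; apply/idP/idP.
    move/mem_ideal_part => /(_ idJH) /jacobian_hessian_idealP[c Jp].
    rewrite -[p](subrK (c *: h)); apply: memv_add; last exact: memvZ (memv_line h).
    exact/mem_ideal_part.
  case/memv_addP => q /mem_ideal_part - /(_ idJ) Jq [_ /vlineP[c ->] ->].
  apply/mem_ideal_part => //; apply/jacobian_hessian_idealP; exists c.
  by rewrite [mpoly_of_dhomog _]/= addrK.
have dJH : \dim (J + <[h]>) = (\dim J).+1.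
  rewrite dimv_disjoint_sum ?dim_vline.
    have -> : h != 0 by apply: contraNneq hJ => ->; apply: mem0v.
    by rewrite addn1.
  apply/eqP; rewrite -subv0; apply/subvP => p; rewrite memv_cap memv0.
  case/andP => + /vlineP[c pE]; rewrite pE; have [->|c0] := eqVneq c 0.
    by rewrite scale0r.
  by rewrite rpredZeq (negPf hJ) (negPf c0).
have := dimvS (subvf (J + <[h]>)%VS); rewrite dJH => leJ.
by rewrite /hilbert_fun JH dJH -/J subnS predn_int ?subn_gt0.
Qed.

End MilnorAlgebra.

Theorem proposition1p4 (R : realType) (n d : nat) (f : {mpoly (R[i])[n.+1]}) :
  (2 <= d)%N -> f != 0 -> f \is d.-homog ->
  let T := (n.+1 * (d - 2))%N in
  (smooth_hypersurface f ->
     HP_H f =1 HP_M f \- fps_poly 'X^T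
     /\ HP_M f \- fps_poly 'X^T =1
        fps_frac ((1 - 'X^(d - 1)) ^+ n.+1) ((1 - 'X) ^+ n.+1)
          \- fps_poly 'X^T)
  /\ (reduced_hypersurface f -> only_isolated_singularities f ->
      ~ smooth_hypersurface f ->
      HP_H f =1 HP_M f).
Proof.
move=> d2 f0 homf T; split=> [smooth|_ _ /existsNP[x /contrapT singx]]; last first.
  exact/(HP_H_hessian_in homf)/(hessian_singular homf d2 singx).
have d1 : (0 < d.-1)%N by lia.
have [g [hg sg rg gJ]] := complete_intersection d1 (fun i => mderiv_homog i homf)
  (fun v k vk => smooth_nozero d2 homf smooth vk).
have idg := gen_ideal g; have idJ := jacobian_ideal_ideal f.
have powJ j : jacobian_ideal f ('X_j ^+ (n.+1 * d.-1.-1).+1).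
  by apply/gJ/(regular_full hg rg sg (ltnSn _)); apply: homogX.
split=> [|k /=]; first exact/(HP_H_hessian_notin homf)/(hessian_notin homf d2 powJ).
congr (_ - _); have -> : HP_M f k = hseries g k.
  by congr (Posz _); apply: eq_hilbert_fun => // p _; rewrite gJ.
have q0 : ((1 - 'X) ^+ n.+1 : {poly int})`_0 = 1.
  by rewrite -horner_coef0 !hornerE ?subr0 expr1n.
apply: (fps_mulI q0) => {}k; rewrite (hseries_complete_intersection hg rg) sg.
by rewrite fps_fracP // subn1.
Qed.
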